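(* Let $f:\mathbb{R}^d\to\mathbb{R}$ be $\mathcal{C}^2$ and strongly convex, $\varepsilon>0$, $\gamma\ge0$, let $\mathbf{A}=A\,\mathbb{I}$ with a constant $A>0$, and let $C(\mathbf{x})=B(\mathbf{x})\nabla^2 f(\mathbf{x})$ with $B(\mathbf{x})\in\mathbb{R}^{d\times d}$ symmetric positive definite, $C$ being differentiable along trajectories. Then any solution $(\mathbf{x}(t),\mathbf{p}(t))$ of the ODE system $$\dot{\mathbf{p}}=\mathbf{A}\nabla f(\mathbf{x})-\varepsilon \mathbf{A}\mathbf{p},\qquad \dot{\mathbf{x}}=-C(\mathbf{x})\big(\mathbf{p}+\gamma(\mathbf{A}\nabla f(\mathbf{x})-\varepsilon \mathbf{A}\mathbf{p})\big)$$ satisfies the second-order ODE $$\ddot{\mathbf{x}}+\big[\varepsilon \mathbf{A}+\gamma C\mathbf{A}\nabla^2 f(\mathbf{x})-\dot{C}C^{-1}\big]\dot{\mathbf{x}}+C\mathbf{A}\nabla f(\mathbf{x})=0,$$ where $C=C(\mathbf{x}(t))$ and $\dot C=\frac{d}{dt}C(\mathbf{x}(t))$.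
   Context: $\mathbb{I}$ is the $d\times d$ identity matrix. *)

(* Defs.v *)
From HB Require Import structures.
From mathcomp Require Import all_boot all_order all_algebra.
From mathcomp Require Import all_classical all_reals all_analysis.

Set Implicit Arguments.
Unset Strict Implicit.
Unset Printing Implicit Defensive.

Import Order.TTheory GRing.Theory Num.Theory.
Import numFieldNormedType.Exports.

Local Open Scope classical_set_scope.
Local Open Scope ring_scope.

Definition dotv (R : realType) (d : nat) (v w : 'cV[R]_d) : R :=
  \sum_i v i 0 * w i 0.

Definition gradient (R : realType) (d : nat) (f : 'cV[R]_d -> R)
    (x : 'cV[R]_d) : 'cV[R]_d :=
  \col_i 'D_(delta_mx i 0) f x.

Definition hessian (R : realType) (d : nat) (f : 'cV[R]_d -> R)
    (x : 'cV[R]_d) : 'M[R]_d :=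
  \matrix_(i, j) 'D_(delta_mx j 0) (fun y => 'D_(delta_mx i 0) f y) x.

(* [derive] returns a junk value where the directional limit does not exist:
   the two differentiability conditions make [gradient] and [hessian]
   meaningful. *)
Definition C2 (R : realType) (d : nat) (f : 'cV[R]_d -> R) : Prop :=
  [/\ forall x, differentiable f x,
      forall x, differentiable (gradient f) x &
      continuous (hessian f)].

(* The modulus refers to the Euclidean norm, so it is written with [dotv]: the
   library's norm on matrices is the maximum norm. *)
Definition strongly_convex (R : realType) (d : nat) (f : 'cV[R]_d -> R) :
    Prop :=
  exists2 mu : R, 0 < mu &
    forall (x y : 'cV[R]_d) (s : R), 0 <= s <= 1 ->
      f (s *: x + (1 - s) *: y) <=
        s * f x + (1 - s) * f y - mu / 2 * (s * (1 - s)) * dotv (x - y) (x - y).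

Definition spd (R : realType) (d : nat) (M : 'M[R]_d) : Prop :=
  M^T = M /\ forall v : 'cV[R]_d, v != 0 -> 0 < dotv v (M *m v).

(* Time derivative relative to J: one-sided at the endpoints that belong to J,
   the usual derivative at interior points (see [derive_within_open]). *)
Definition derivable_within (R : realType) (V : normedModType R) (J : set R)
    (u : R -> V) (t : R) : Prop :=
  cvg ((fun h => h^-1 *: (u (h + t) - u t)) @
       within [set h | J (h + t)] 0^').

Definition derive_within (R : realType) (V : normedModType R) (J : set R)
    (u : R -> V) (t : R) : V :=
  lim ((fun h => h^-1 *: (u (h + t) - u t)) @
       within [set h | J (h + t)] 0^').

Lemma within_open_dnbhs (R : realType) (J : set R) (t : R) :
  open J -> J t -> within [set h | J (h + t)] 0^' = (0 : R)^'.
Proof.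
move=> oJ Jt; apply/seteqP; split => P /=; last first.
  by rewrite /within /=; apply: filterS => h Ph _.
have JN : \forall h \near (0 : R), J (h + t).
  have ct : (fun h : R => h + t) @ (0 : R) --> (0 + t).
    by apply: cvgD; [exact: cvg_id | exact: cvg_cst].
  by rewrite add0r in ct; apply: ct; exact: open_nbhs_nbhs.
rewrite /dnbhs /within /= => HP.
exact: (filterS2 _ (fun h (Hh : h != 0 -> J (h + t) -> P h) Jh h0 => Hh h0 Jh) HP JN).
Qed.

Lemma derivable_within_open (R : realType) (V : normedModType R) (J : set R)
    (u : R -> V) (t : R) :
  open J -> J t -> derivable_within J u t <-> derivable u t 1.
Proof.
move=> oJ Jt; rewrite /derivable_within within_open_dnbhs // /derivable.
by under [X in _ <-> cvg (X @ _)]eq_fun do rewrite [_ *: 1]mulr1.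
Qed.

Lemma derive_within_open (R : realType) (V : normedModType R) (J : set R)
    (u : R -> V) (t : R) :
  open J -> J t -> derive_within J u t = derive1 u t.
Proof. by move=> oJ Jt; rewrite /derive_within within_open_dnbhs. Qed.

(* Main.v *)
Require Import Defs.
From HB Require Import structures.
From mathcomp Require Import all_boot all_order all_algebra.
From mathcomp Require Import all_classical all_reals all_analysis.
From mathcomp Require Import ring lra.

Import Order.TTheory GRing.Theory Num.Theory.
Import numFieldNormedType.Exports.

Local Open Scope classical_set_scope.
Local Open Scope ring_scope.

Set Implicit Arguments.
Unset Strict Implicit.
Unset Printing Implicit Defensive.

(** Put w = p + gamma (A grad f(x) - eps A p), so that x' = - C w along a
    trajectory.  The right-hand side is differentiable in time: p and C(x(.))
    are by assumption, and grad f(x(.)) has derivative H x', with H the Hessian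
    of f at x(t), by the chain rule [has_derive_within_comp].  The product rule
    [has_derive_within_mulmx] therefore gives
      x'' = - C' w - C w',
      w' = p' + gamma (A H x' - eps A p').
    As C is invertible, w = - C^-1 x' and - C' w = C' C^-1 x'.  The chain
    rule term contributes - gamma C A H x' to - C w', and for the rest of C w'
      C (p' - gamma eps A p') = C A grad f(x) - eps A C (p + gamma p')
                              = C A grad f(x) + eps A x'
    because p' = A grad f(x) - eps A p.  Scalar matrices commute with C, which
    is what lets eps A pass through it.

    Strong convexity enters through the invertibility of C = B H: it makes the
    gradient strongly monotone ([gradient_strongly_monotone]), and differentiating
    this inequality along a line gives <H v, v> >= mu <v, v>
    ([hessian_coercive]), so H has trivial kernel; so has B, being positive
    definite. *)

(** * Limits of matrices *)

(** Matrices carry the maximum norm over finitely many entries, so convergence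
    can be checked entry by entry. *)
Lemma cvg_mxP (R : realType) (T : Type) (F : set_system T) (FF : Filter F)
    (m n : nat) (M : T -> 'M[R]_(m, n)) (L : 'M[R]_(m, n)) :
  M s @[s --> F] --> L <-> forall i j, M s i j @[s --> F] --> L i j.
Proof.
split=> [ML i j|ML].
  exact: (cvg_comp M (fun N : 'M[R]_(m, n) => N i j) ML
            (@coord_continuous _ m n i j L)).
apply/cvgrPdist_le => /= e e0; near=> s.
rewrite /Num.Def.normr/= mx_normrE (bigmax_le _ (ltW e0))//= => i _.
rewrite !mxE; move: i; near: s; apply: filter_forall => /= i.
exact: (cvgrPdist_le _ _).1 (ML i.1 i.2) e e0.
Unshelve. all: by end_near. Qed.

Lemma cvg_mulmx (R : realType) (T : Type) (F : set_system T) (FF : Filter F)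
    (m n k : nat) (M : T -> 'M[R]_(m, n)) (N : T -> 'M[R]_(n, k))
    (L : 'M[R]_(m, n)) (K : 'M[R]_(n, k)) :
  M s @[s --> F] --> L -> N s @[s --> F] --> K ->
  M s *m N s @[s --> F] --> L *m K.
Proof.
move=> /cvg_mxP ML /cvg_mxP NK; apply/cvg_mxP => i j.
rewrite mxE; under eq_fun do rewrite mxE.
by apply: cvg_big => [|l _]; [exact: add_continuous | exact: cvgM].
Qed.

(** * Derivatives relative to a set of times *)

(** The relational form of the derivative relative to [J]: the calculus rules
    hold in this form at every [t], whereas speaking of the value of a limit
    requires [t] to be an accumulation point of [J]. *)
Definition has_derive_within (R : realType) (V : normedModType R) (J : set R)
    (u : R -> V) (t : R) (l : V) : Prop :=
  h^-1 *: (u (h + t) - u t) @[h --> within [set h | J (h + t)] 0^'] --> l.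

(** A nondegenerate interval has no isolated point: from [t] one can move an
    arbitrarily small fraction of the way towards another point of [J].  This
    is what makes derivatives relative to [J] unique. *)
Lemma within_shift_proper (R : realType) (J : set R) (t : R) :
  is_interval J -> (exists a b, [/\ J a, J b & a < b]) -> J t ->
  ProperFilter (within [set h | J (h + t)] 0^').
Proof.
move=> Jitv [a [b [Ja Jb ab]]] Jt.
have [s Js st] : exists2 s, J s & s != t.
  have [at_|] := eqVneq a t; last by exists a.
  by exists b => //; rewrite -at_ gt_eqF.
apply: Build_ProperFilter_ex => P; rewrite /within /= /dnbhs /within /=.
move=> /nbhs_ballP[e /= e0 eP].
have st0 : 0 < `|s - t| by rewrite normr_gt0 subr_eq0.
(* A fraction of the segment from t to s of length below e; the cap at 1 keeps
   the point inside the segment. *)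
pose th := Num.min 1 (e / 2 / `|s - t|).
have th0 : 0 < th by rewrite lt_min ltr01 !divr_gt0.
have th1 : th <= 1 by rewrite ge_min lexx.
exists (th * (s - t)); apply: eP.
- rewrite /ball /= sub0r normrN normrM gtr0_norm //.
  rewrite -ltr_pdivlMr//; apply: (@le_lt_trans _ _ (e / 2 / `|s - t|)).
    by rewrite ge_min lexx orbT.
  by rewrite ltr_pM2r ?invr_gt0//; lra.
- by rewrite mulf_neq0 ?subr_eq0// gt_eqF.
- have [ts|ts] := leP t s.
    apply: (Jitv t s) => //; apply/andP; split; nra.
  apply: (Jitv s t) => //; apply/andP; split; nra.
Qed.

Section Calculus.
Context {R : realType} (J : set R) (t : R).
Local Notation F := (within [set h | J (h + t)] 0^').

Lemma near_within_shift (P : R -> Prop) :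
  (forall h, h != 0 -> J (h + t) -> P h) -> \forall h \near F, P h.
Proof.
move=> HP; near=> h; apply: HP; near: h; last exact: withinT.
exact: (@cvg_within _ 0^' _ _ _ (nbhs_dnbhs_neq (0 : R))).
Unshelve. all: by end_near. Qed.

Lemma derivable_withinP (V : normedModType R) (u : R -> V) :
  derivable_within J u t -> has_derive_within J u t (derive_within J u t).
Proof. by []. Qed.

Lemma has_derive_withinE (V : normedModType R) (u : R -> V) l :
  is_interval J -> (exists a b, [/\ J a, J b & a < b]) -> J t ->
  has_derive_within J u t l ->
  derivable_within J u t /\ derive_within J u t = l.
Proof.
move=> J1 J2 Jt ul; have FF := within_shift_proper J1 J2 Jt.
by split; [exact: cvgP ul | exact: cvg_lim].
Qed.

Lemma has_derive_within_eq (V : normedModType R) (u v : R -> V) l :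
  J t -> (forall s, J s -> u s = v s) ->
  has_derive_within J u t l -> has_derive_within J v t l.
Proof.
move=> Jt uv; apply: cvg_trans; apply: near_eq_cvg.
by apply: near_within_shift => h _ Jh /=; rewrite !uv.
Qed.

Lemma has_derive_withinD (V : normedModType R) (u v : R -> V) k l :
  has_derive_within J u t k -> has_derive_within J v t l ->
  has_derive_within J (fun s => u s + v s) t (k + l).
Proof.
move=> uk vl; rewrite /has_derive_within.
under eq_fun do rewrite opprD addrACA scalerDr.
exact: cvgD.
Qed.

Lemma has_derive_withinZ (V : normedModType R) (u : R -> V) (c : R) l :
  has_derive_within J u t l ->
  has_derive_within J (fun s => c *: u s) t (c *: l).
Proof.
move=> ul; rewrite /has_derive_within.
under eq_fun do rewrite -scalerBr scalerA mulrC -scalerA.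
exact: cvgZl_tmp.
Qed.

Lemma has_derive_withinN (V : normedModType R) (u : R -> V) l :
  has_derive_within J u t l ->
  has_derive_within J (fun s => - u s) t (- l).
Proof.
move=> /(has_derive_withinZ (c := -1)); rewrite scaleN1r.
by under eq_fun do rewrite scaleN1r.
Qed.

Lemma cvg_id_within : h @[h --> F] --> (0 : R).
Proof. exact: cvg_trans (cvg_within _) (cvg_within _). Qed.

(** Differentiability implies continuity: the increment is h times the
    difference quotient. *)
Lemma increment_cvg0 (V : normedModType R) (u : R -> V) l :
  has_derive_within J u t l -> u (h + t) - u t @[h --> F] --> 0.
Proof.
move=> ul; rewrite -(scale0r l).
apply: cvg_trans (cvgZ cvg_id_within ul).
apply: near_eq_cvg; apply: near_within_shift => h h0 _.
by rewrite scalerA divff// scale1r.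
Qed.

(** The usual splitting
    M(h+t) N(h+t) - M(t) N(t) = (M(h+t) - M(t)) N(h+t) + M(t) (N(h+t) - N(t)),
    kept in this order since matrices do not commute. *)
Lemma has_derive_within_mulmx (m n k : nat) (M : R -> 'M[R]_(m, n))
    (N : R -> 'M[R]_(n, k)) M' N' :
  has_derive_within J M t M' -> has_derive_within J N t N' ->
  has_derive_within J (fun s => M s *m N s) t (M' *m N t + M t *m N').
Proof.
move=> MM NN.
have Nt : N (h + t) @[h --> F] --> N t.
  rewrite -[X in _ --> X]add0r.
  apply: cvg_trans (cvgD (increment_cvg0 NN) (cvg_cst (N t))).
  by apply: near_eq_cvg; apply: nearW => h; rewrite subrK.
apply: cvg_trans (cvgD (cvg_mulmx _ MM Nt) (cvg_mulmx _ (cvg_cst (M t)) NN)).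
apply: near_eq_cvg; apply: nearW => h /=.
rewrite !fctE -scalemxAl -scalemxAr -scalerDr; congr (_ *: _).
by rewrite mulmxBl mulmxBr addrA subrK.
Qed.

(** Chain rule.  With [k h] the increment of [u] and [r] the remainder of the
    expansion of [g] at [u t], the difference quotient of [g \o u] is
    'd g (k h / h) + r (k h) / h.  The first term converges because 'd g is
    continuous; the second vanishes because r (k h) = o(k h) while k h / h stays
    bounded. *)
Lemma has_derive_within_comp (V W : normedModType R) (g : V -> W) (u : R -> V) l :
  differentiable g (u t) -> has_derive_within J u t l ->
  has_derive_within J (g \o u) t ('d g (u t) l).
Proof.
move=> dg ul.
pose k h := u (h + t) - u t.
pose r v := g (v + u t) - g (u t) - 'd g (u t) v.
have r_o : forall e, 0 < e -> \forall v \near (0 : V), `|r v| <= e * `|v|.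
  move=> e e0.
  have /eqaddoP := diff_locally dg.
  move=> /(_ e e0); apply: filterS => v.
  by rewrite /r/= !fctE /= opprD addrA.
have dc : 'd g (u t) (h^-1 *: k h) @[h --> F] --> 'd g (u t) l.
  have dgl := @diff_continuous _ _ _ _ _ dg l.
  exact: (cvg_comp (fun h => h^-1 *: k h) ('d g (u t)) ul dgl).
have r0 : h^-1 *: r (k h) @[h --> F] --> 0.
  apply/cvgr0Pnorm_le => e e0; near=> h.
  have L1 : 0 < `|l| + 1 by rewrite ltr_wpDl.
  have rk : `|r (k h)| <= e / (`|l| + 1) * `|k h|.
    near: h; have eL : 0 < e / (`|l| + 1) by rewrite divr_gt0.
    by move: (increment_cvg0 ul) => /(_ _ (r_o _ eL)).
  have kl : `|h^-1 *: k h| <= `|l| + 1.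
    by near: h; apply: (cvgr_norm_le _ ul); rewrite ltrDl.
  rewrite normrZ; apply: le_trans (ler_wpM2l (normr_ge0 _) rk) _.
  rewrite mulrCA -normrZ mulrAC ler_pdivrMr//.
  by rewrite ler_pM2l.
rewrite /has_derive_within -[X in _ --> X]addr0.
apply: cvg_trans (cvgD dc r0).
apply: near_eq_cvg; apply: nearW => h /=.
rewrite !fctE linearZ /= -scalerDr /r /k /=; congr (_ *: _).
by rewrite subrK addrC subrK.
Unshelve. all: by end_near. Qed.

End Calculus.

(** * Gradient and Hessian as differentials *)

Lemma diff_col_expansion (R : realType) (d : nat) (W : normedModType R)
    (g : 'cV[R]_d -> W) (y v : 'cV[R]_d) : differentiable g y ->
  'd g y v = \sum_i v i 0 *: 'D_(delta_mx i 0) g y.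
Proof.
move=> dg.
have {1}-> : v = \sum_i v i 0 *: delta_mx i 0.
  by rewrite {1}(matrix_sum_delta v); apply: eq_bigr => i _; rewrite big_ord1.
by rewrite linear_sum; apply: eq_bigr => i _; rewrite linearZ/= deriveE.
Qed.

Lemma diff_gradient (R : realType) (d : nat) (f : 'cV[R]_d -> R)
    (y v : 'cV[R]_d) :
  differentiable f y -> 'd f y v = dotv (gradient f y) v.
Proof.
move=> df; rewrite diff_col_expansion//; apply: eq_bigr => i _.
by rewrite mxE mulrC.
Qed.

Lemma diff_hessian (R : realType) (d : nat) (f : 'cV[R]_d -> R)
    (y v : 'cV[R]_d) :
  differentiable (gradient f) y -> 'd (gradient f) y v = hessian f y *m v.
Proof.
move=> dg; rewrite diff_col_expansion//; apply/colP => i.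
rewrite summxE mxE; apply: eq_bigr => j _.
rewrite mxE [RHS]mulrC mxE; congr (_ * _).
rewrite derive_mx; last exact: diff_derivable.
by rewrite mxE; under eq_fun do rewrite mxE.
Qed.

(** * The Euclidean inner product *)

Section Dotv.
Context {R : realType} {d : nat}.
Implicit Types u v w : 'cV[R]_d.

Lemma dotvE u v : dotv u v = (v^T *m u) 0 0.
Proof. by rewrite mxE; apply: eq_bigr => i _; rewrite mxE mulrC. Qed.

Lemma dotvC u v : dotv u v = dotv v u.
Proof. by apply: eq_bigr => i _; rewrite mulrC. Qed.

Lemma dotvBl u v w : dotv (u - v) w = dotv u w - dotv v w.
Proof. by rewrite !dotvE mulmxBr !mxE. Qed.

Lemma dotvZl c u w : dotv (c *: u) w = c * dotv u w.
Proof. by rewrite !dotvE -scalemxAr !mxE. Qed.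

Lemma dotvZr c u w : dotv u (c *: w) = c * dotv u w.
Proof. by rewrite dotvC dotvZl dotvC. Qed.

Lemma dotvNr u w : dotv u (- w) = - dotv u w.
Proof. by rewrite -scaleN1r dotvZr mulN1r. Qed.

Lemma dotv_gt0 v : v != 0 -> 0 < dotv v v.
Proof.
move=> v0; rewrite lt_def sumr_ge0 ?andbT => [|i _]; last exact: sqr_ge0.
apply: contra_neq v0 => /eqP; rewrite psumr_eq0 => [/allP v0|i _]; last exact: sqr_ge0.
apply/colP => i; rewrite mxE; apply/eqP.
by have := v0 i (mem_index_enum i); rewrite mulf_eq0 orbb.
Qed.

Lemma cvg_dotvl (T : Type) (F : set_system T) (FF : Filter F)
    (u : T -> 'cV[R]_d) (l w : 'cV[R]_d) :
  u s @[s --> F] --> l -> dotv (u s) w @[s --> F] --> dotv l w.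
Proof.
move=> ul; rewrite dotvE; under eq_fun do rewrite dotvE.
by apply: (cvg_mxP _ _ _).1; apply: cvg_mulmx ul; exact: cvg_cst.
Qed.

End Dotv.

(** * Strong convexity and invertibility *)

(** The inequality of [strongly_convex] for one given modulus, which the
    estimates below carry through. *)
Definition convex_with_modulus (R : realType) (d : nat) (mu : R)
    (f : 'cV[R]_d -> R) : Prop :=
  forall (x y : 'cV[R]_d) (s : R), 0 <= s <= 1 ->
    f (s *: x + (1 - s) *: y) <=
      s * f x + (1 - s) * f y - mu / 2 * (s * (1 - s)) * dotv (x - y) (x - y).

(** Divide the convexity inequality by its parameter and let it tend to 0 from
    the right: the left-hand side tends to the derivative of [f] at [y] in the
    direction [x - y]. *)
Lemma strongly_convex_first_order (R : realType) (d : nat) (f : 'cV[R]_d -> R)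
    (mu : R) (x y : 'cV[R]_d) :
  convex_with_modulus mu f ->
  differentiable f y ->
  dotv (gradient f y) (x - y) <= f x - f y - mu / 2 * dotv (x - y) (x - y).
Proof.
move=> fsc df; rewrite -(diff_gradient _ df).
have D : h^-1 * (f (h *: (x - y) + y) - f y) @[h --> 0^'+] --> 'd f y (x - y).
  rewrite -deriveE//; apply: cvg_dnbhs_at_right.
  exact: (@diff_derivable _ _ _ f y (x - y) df).
have E : f x - f y - mu / 2 * (1 - h) * dotv (x - y) (x - y) @[h --> (0 : R)^'+]
    --> f x - f y - mu / 2 * (1 - 0) * dotv (x - y) (x - y).
  apply: cvgB; first exact: cvg_cst.
  apply: cvgM; last exact: cvg_cst.
  apply: cvgM; first exact: cvg_cst.
  apply: cvgB; first exact: cvg_cst.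
  exact: cvg_at_right_filter cvg_id.
rewrite subr0 mulr1 in E.
apply: (ler_cvg_to D E); near=> h.
have h0 : 0 < h by near: h; exact: nbhs_right_gt.
have h1 : h < 1 by near: h; exact: nbhs_right_lt.
rewrite ler_pdivrMl//.
have -> : h *: (x - y) + y = h *: x + (1 - h) *: y.
  by rewrite scalerBr scalerBl scale1r addrA addrAC.
have := fsc x y h; rewrite (ltW h0) (ltW h1) => /(_ isT).
lra.
Unshelve. all: by end_near. Qed.

(** Add the first-order inequality at [(x, y)] to the one at [(y, x)]: the
    values of [f] cancel. *)
Lemma gradient_strongly_monotone (R : realType) (d : nat) (f : 'cV[R]_d -> R)
    (mu : R) (x y : 'cV[R]_d) :
  convex_with_modulus mu f ->
  (forall z, differentiable f z) ->
  mu * dotv (x - y) (x - y) <= dotv (gradient f x - gradient f y) (x - y).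
Proof.
move=> fsc df.
have := strongly_convex_first_order x fsc (df y).
have := strongly_convex_first_order y fsc (df x).
have -> : y - x = - (x - y) by rewrite opprB.
rewrite (dotvBl (gradient f x)) !dotvNr [dotv (- _) _]dotvC dotvNr; lra.
Qed.

(** Apply strong monotonicity to [y + h v] and [y], divide by [h ^ 2], and let
    [h] tend to 0 from the right. *)
Lemma hessian_coercive (R : realType) (d : nat) (f : 'cV[R]_d -> R)
    (mu : R) (y v : 'cV[R]_d) :
  convex_with_modulus mu f ->
  (forall z, differentiable f z) -> differentiable (gradient f) y ->
  mu * dotv v v <= dotv (hessian f y *m v) v.
Proof.
move=> fsc df dg.
have D : h^-1 *: (gradient f (h *: v + y) - gradient f y) @[h --> 0^'+]
    --> hessian f y *m v.
  rewrite -(diff_hessian _ dg) -(deriveE _ dg); apply: cvg_dnbhs_at_right.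
  exact: (@diff_derivable _ _ _ (gradient f) y v dg).
apply: (cvgr_to_ge (cvg_dotvl (w := v) _ D)); near=> h.
have h0 : 0 < h by near: h; exact: nbhs_right_gt.
have := gradient_strongly_monotone (h *: v + y) y fsc df.
rewrite addrK dotvZl !dotvZr dotvZl.
by rewrite mulrCA ler_pM2l// mulrCA -ler_pdivlMl.
Unshelve. all: by end_near. Qed.

Lemma unitmx_ker0 (K : fieldType) (n : nat) (M : 'M[K]_n) :
  (forall v : 'cV[K]_n, M *m v = 0 -> v = 0) -> M \in unitmx.
Proof.
move=> M0; rewrite -unitmx_tr -row_free_unit; apply: inj_row_free => v vM.
by apply: trmx_inj; rewrite trmx0; apply: M0; rewrite -[LHS]trmxK trmx_mul trmxK vM trmx0.
Qed.

Lemma hessian_unit (R : realType) (d : nat) (f : 'cV[R]_d -> R) (y : 'cV[R]_d) :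
  C2 f -> strongly_convex f -> hessian f y \in unitmx.
Proof.
move=> [df dg _] [mu mu0 fsc]; apply: unitmx_ker0 => v Hv.
apply: contraPeq (hessian_coercive v fsc df (dg y)) => v0.
apply/negP; rewrite -ltNge Hv dotvE mulmx0 mxE.
by rewrite mulr_gt0// dotv_gt0.
Qed.

Lemma spd_unit (R : realType) (d : nat) (M : 'M[R]_d) : spd M -> M \in unitmx.
Proof.
move=> [_ Mpos]; apply: unitmx_ker0 => v Mv; apply/eqP/negPn/negP => /Mpos.
by rewrite Mv dotvC dotvE mulmx0 mxE ltxx.
Qed.

(** * The second-order equation *)

Unset Implicit Arguments.
Set Strict Implicit.
Set Printing Implicit Defensive.

Theorem proposition2p4 (R : realType) (d : nat) (f : 'cV[R]_d -> R)
    (eps gamma A : R) (B C : 'cV[R]_d -> 'M[R]_d)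
    (J : set R) (x p : R -> 'cV[R]_d)
    (f_C2 : C2 f) (f_sconvex : strongly_convex f)
    (eps_gt0 : 0 < eps) (gamma_ge0 : 0 <= gamma) (A_gt0 : 0 < A)
    (B_spd : forall y, spd (B y))
    (C_def : forall y, C y = B y *m hessian f y)
    (J_itv : is_interval J)
    (J_nontrivial : exists a b, [/\ J a, J b & a < b])
    (Cx_derivable : forall t, J t -> derivable_within J (fun s => C (x s)) t)
    (p_derivable : forall t, J t -> derivable_within J p t)
    (p_ode : forall t, J t ->
       derive_within J p t = A%:M *m gradient f (x t) - eps *: (A%:M *m p t))
    (x_derivable : forall t, J t -> derivable_within J x t)
    (x_ode : forall t, J t ->
       derive_within J x t =
         - (C (x t) *m
             (p t +
              gamma *: (A%:M *m gradient f (x t) - eps *: (A%:M *m p t))))) :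
  forall t, J t ->
    derivable_within J (derive_within J x) t /\
    derive_within J (derive_within J x) t +
      (eps *: A%:M + gamma *: (C (x t) *m A%:M *m hessian f (x t)) -
         derive_within J (fun s => C (x s)) t *m invmx (C (x t))) *m
        derive_within J x t +
      C (x t) *m A%:M *m gradient f (x t) = 0.
Proof.
move=> t Jt.
have C_unit : C (x t) \in unitmx.
  by rewrite C_def unitmx_mul spd_unit// hessian_unit.
have [_ /(_ (x t)) dg _] := f_C2.
have x' := derivable_withinP (x_derivable t Jt).
have p' := derivable_withinP (p_derivable t Jt).
have C' := derivable_withinP (Cx_derivable t Jt).
have g' := has_derive_within_comp dg x'; rewrite (diff_hessian _ dg) in g'.
have w' := has_derive_withinD p'
  (has_derive_withinZ (c := gamma)
    (has_derive_withinD (has_derive_withinZ (c := A) g')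
      (has_derive_withinN
        (has_derive_withinZ (c := eps) (has_derive_withinZ (c := A) p'))))).
(* The equation for x' holds at every time of J, so its right-hand side may be
   differentiated in place of x'. *)
have x_eq s : J s ->
    - (C (x s) *m (p s + gamma *: (A *: gradient f (x s) - eps *: (A *: p s))))
    = derive_within J x s.
  by move=> Js; rewrite (x_ode s Js) !mul_scalar_mx.
have x'' := has_derive_within_eq Jt x_eq
  (has_derive_withinN (has_derive_within_mulmx C' w')).
have [dx' ->] := has_derive_withinE J_itv J_nontrivial Jt x''; split=> //.
set X := derive_within J x t in x' g' w' x'' *.
set C't := derive_within J (fun s => C (x s)) t.
(* - C' w = C' C^-1 x' *)
have -> : C't *m (p t + gamma *: (A *: (gradient f \o x) t - eps *: (A *: p t)))
    = - (C't *m invmx (C (x t)) *m X).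
  by rewrite /X x_ode// mulmxN opprK mulmxA mulmxKV// !mul_scalar_mx.
rewrite mulmxBl [X in _ + (X - _)]mulmxDl -!scalemxAl !mul_mx_scalar -!scalemxAl.
rewrite mul_scalar_mx -(mulmxA (C (x t)) (hessian f (x t)) X).
(* Once everything is expanded in the vectors C' C^-1 x', C H x', C p and
   C grad f(x), the scalars being moved to the front, the remaining occurrence
   of x' is replaced by its own expression; the coefficients then cancel. *)
have : X = - (C (x t) *m p t) - gamma *: (A *: (C (x t) *m gradient f (x t)) -
    eps *: (A *: (C (x t) *m p t))).
  rewrite /X x_ode// !mul_scalar_mx mulmxDr -scalemxAr mulmxBr -!scalemxAr.
  by rewrite opprD.
rewrite p_ode// !mul_scalar_mx.
rewrite !(mulmxDr, mulmxBr, mulmxN) -!scalemxAr !(mulmxDr, mulmxBr, mulmxN) -!scalemxAr.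
rewrite !(mulmxDr, mulmxBr, mulmxN) -!scalemxAr.
move: (C't *m _ *m X) (C (x t) *m (_ *m _)) (C (x t) *m p t) (C (x t) *m gradient f (x t)).
move=> U V P G XE.
rewrite [in eps *: (A *: X)]XE.
apply/colP => i; rewrite !mxE; ring.
Qed.
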